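(* Let $k,d$ be positive integers and $\lambda>0$. If the independent sets of $\mathbb{T}_{k,d}$ with activity $\lambda$ exhibit strong spatial mixing with rate $\delta(\cdot)$, then the independent sets with activity $\lambda$ of every finite hypergraph of maximum edge-size at most $k+1$ and maximum degree at most $d+1$ exhibit strong spatial mixing with the same rate $\delta(\cdot)$.
   Context: $\mathbb{T}_{k,d}$ is the infinite $(k+1)$-uniform $(d+1)$-regular hypertree (incidence graph is the infinite tree with vertex-nodes of degree $d+1$ and hyperedge-nodes of degree $k+1$). An independent set of a hypergraph $\mathcal{H}=(V,E)$ is $I\subseteq V$ with $|I\cap e|\le1$ for all $e\in E$; the Gibbs measure on a finite hypergraph is $\mu(I)\propto\lambda^{|I|}$. For $v\in V$, $\Lambda\subseteq V$ and $\sigma_\Lambda\in\{0,1\}^\Lambda$ (a partially specified independent set), $p_v^{\sigma_\Lambda}=\Pr[v\in I\mid I\cap\Lambda=\sigma_\Lambda^{-1}(1)]$. A finite hypergraph exhibits strong spatial mixing (SSM) with rate $\delta:\mathbb{N}\to\mathbb{R}^+$ if for all $v\in V$, $\Lambda\subseteq V$ and $\sigma_\Lambda,\tau_\Lambda$, $|p_v^{\sigma_\Lambda}-p_v^{\tau_\Lambda}|\le\delta(\mathrm{dist}(v,\Delta))$, where $\Delta\subseteq\Lambda$ is the set where they differ and $\mathrm{dist}$ is the shortest-path distance in the hypergraph (two vertices adjacent iff they share a hyperedge). An infinite hypergraph exhibits SSM with rate $\delta$ if for every finite vertex set $\Psi$ the same inequality holds (with distances in the infinite hypergraph) for the Gibbs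 measure on the independent sets contained in $\Psi$, i.e. the measure conditioned on all vertices outside $\Psi$ adjacent to $\Psi$ being unoccupied, for all $v\in\Psi$, $\Lambda\subseteq\Psi$. *)

(* Defs.v *)
From HB Require Import structures.
From mathcomp Require Import all_boot all_order all_algebra.
From mathcomp Require Import finmap boolp classical_sets functions cardinality.
From mathcomp Require Import reals.

Set Implicit Arguments.
Unset Strict Implicit.
Unset Printing Implicit Defensive.

Import Order.TTheory GRing.Theory Num.Theory.

Local Open Scope classical_set_scope.
Local Open Scope card_scope.
Local Open Scope ring_scope.
Local Open Scope fset_scope.

(* A hypergraph on V is its set of hyperedges; V may be infinite, but every
   hyperedge is a finite set of vertices. *)
Definition hypergraph (V : choiceType) : Type := set {fset V}.

Section Hypergraph.
Variables (V : choiceType) (H : hypergraph V).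

Definition star (v : V) : set {fset V} := [set e | H e /\ v \in e].

Definition uniform (m : nat) : Prop := forall e, H e -> #|` e| = m.
Definition regular (m : nat) : Prop := forall v, star v #= `I_m.
Definition edge_size_le (m : nat) : Prop := forall e, H e -> (#|` e| <= m)%N.
Definition degree_le (m : nat) : Prop := forall v, star v #<= `I_m.

Definition adjacent (u v : V) : Prop :=
  u != v /\ exists e, [/\ H e, u \in e & v \in e].

Fixpoint walk (n : nat) (u v : V) : Prop :=
  if n is m.+1 then exists w, adjacent u w /\ walk m w v else u = v.

Definition reaches (v : V) (D : {fset V}) (n : nat) : bool :=
  `[< exists u, u \in D /\ walk n v u >].

(* None stands for infinite distance; this includes the case D = fset0. *)
Definition dist (v : V) (D : {fset V}) : option nat :=
  if pselect (exists n, reaches v D n) is left ex then Some (ex_minn ex)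
  else None.

Definition independent (I : {fset V}) : Prop :=
  forall e, H e -> (#|` I `&` e| <= 1)%N.

Definition indsets (Psi : {fset V}) : {fset {fset V}} :=
  [fset I in fpowerset Psi | `[< independent I >]].

(* Only the values of sigma on L matter: together with L, the function sigma
   encodes an element of {0,1}^L, and [occupied L sigma] is its preimage
   of 1. *)
Definition occupied (L : {fset V}) (sigma : V -> bool) : {fset V} :=
  [fset u in L | sigma u].

Definition disagreement (L : {fset V}) (sigma tau : V -> bool) : {fset V} :=
  [fset u in L | sigma u != tau u].

Variables (R : realType) (lambda : R).

(* The Gibbs measure on the independent sets contained in Psi, i.e. with every
   vertex outside Psi unoccupied. *)
Definition partition_function (Psi : {fset V}) : R :=
  \sum_(I <- indsets Psi) lambda ^+ #|` I|.

Definition gibbs (Psi I : {fset V}) : R :=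
  if I \in indsets Psi then lambda ^+ #|` I| / partition_function Psi else 0.

Definition gibbs_pr (Psi : {fset V}) (P : pred {fset V}) : R :=
  \sum_(I <- indsets Psi | P I) gibbs Psi I.

Definition gibbs_cond_pr (Psi : {fset V}) (P Q : pred {fset V}) : R :=
  gibbs_pr Psi (predI P Q) / gibbs_pr Psi Q.

Definition marginal (Psi L : {fset V}) (sigma : V -> bool) (v : V) : R :=
  gibbs_cond_pr Psi (fun I => v \in I)
                    (fun I => I `&` L == occupied L sigma).

(* The rate at infinite distance is taken to be 0. *)
Definition ssm_in (delta : nat -> R) (Psi : {fset V}) : Prop :=
  forall (v : V) (L : {fset V}) (sigma tau : V -> bool),
    v \in Psi -> L `<=` Psi ->
    independent (occupied L sigma) -> independent (occupied L tau) ->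
    `|marginal Psi L sigma v - marginal Psi L tau v|
      <= oapp delta 0 (dist v (disagreement L sigma tau)).

Definition infinite_ssm (delta : nat -> R) : Prop :=
  forall Psi : {fset V}, ssm_in delta Psi.

End Hypergraph.

Definition finite_ssm (V : finType) (H : hypergraph V)
    (R : realType) (lambda : R) (delta : nat -> R) : Prop :=
  ssm_in H lambda delta [fset v | v : V].

Section IncidenceGraph.
Variables (V : choiceType) (H : hypergraph V).

Definition node (x : V + {fset V}) : Prop :=
  if x is inr e then H e else True.

Definition incident (x y : V + {fset V}) : bool :=
  match x, y with
  | inl v, inr e | inr e, inl v => `[< H e >] && (v \in e)
  | _, _ => false
  end.

Definition incidence_tree : Prop :=
  (forall x y, node x -> node y ->
     exists p, path incident x p /\ last x p = y) /\
  (forall c, (2 < size c)%N -> uniq c -> ~~ cycle incident c).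

End IncidenceGraph.

(* The hyperedges around each vertex are coloured by 'I_d.+1, every hyperedge
   having the same colour at all its vertices. A vertex is encoded by the
   non-backtracking route from the root, most recent step first: (i, j) :: u is
   the j-th of the k vertices other than u of the i-coloured hyperedge at u. *)
Definition reduced (k d : nat) : pred (seq ('I_d.+1 * 'I_k)) :=
  sorted (fun a b => a.1 != b.1).

Definition tree_vertex (k d : nat) : choiceType :=
  {w : seq ('I_d.+1 * 'I_k) | reduced w}.

(* Should the hyperedge coloured i lead from u back to the root, then
   (i, j) :: val u is not reduced and tree_child u i j is u by default;
   hypertree never uses this case. *)
Definition tree_child (k d : nat) (u : tree_vertex k d) (i : 'I_d.+1)
    (j : 'I_k) : tree_vertex k d :=
  insubd u ((i, j) :: val u).

Definition tree_edge (k d : nat) (u : tree_vertex k d) (i : 'I_d.+1) :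
    {fset tree_vertex k d} :=
  u |` [fset tree_child u i j | j : 'I_k].

Definition hypertree (k d : nat) : hypergraph (tree_vertex k d) :=
  [set e | exists (u : tree_vertex k d) (i : 'I_d.+1),
     ohead (unzip1 (val u)) != Some i /\ e = tree_edge u i].

Arguments tree_vertex : clear implicits.
Arguments hypertree : clear implicits.

Section HypertreeTheory.
Variables k d : nat.
Implicit Types (u v w : tree_vertex k d) (i : 'I_d.+1) (j : 'I_k).

Let fresh u i : bool := ohead (unzip1 (val u)) != Some i.

Lemma val_tree_child u i j : fresh u i -> val (tree_child u i j) = (i, j) :: val u.
Proof.
move=> fr; rewrite /tree_child val_insubd ifT // /reduced.
case: u fr => -[|[i' j'] s] /= rs; first by [].
rewrite /fresh /= => ne; apply/andP; split; last exact: rs.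
by apply: contra ne => /eqP ->.
Qed.

Lemma in_tree_edge u i w : fresh u i ->
  reflect (w = u \/ exists j, val w = (i, j) :: val u) (w \in tree_edge u i).
Proof.
move=> fr; rewrite /tree_edge in_fset1U; apply: (iffP orP) => -[].
- by move/eqP; left.
- by case/imfsetP => j _ ->; right; exists j; rewrite val_tree_child.
- by move->; left.
case=> j Ej; right; apply/imfsetP; exists j => //.
by apply: val_inj; rewrite val_tree_child.
Qed.

Lemma tree_edge_inj u u' i i' : (0 < k)%N -> fresh u i -> fresh u' i' ->
  tree_edge u i = tree_edge u' i' -> u = u' /\ i = i'.
Proof.
move=> k0 fr fr' E; have [ii'|ne] := eqVneq i i'.
  subst i'; split=> //; have : u \in tree_edge u' i.
    by rewrite -E; apply/in_tree_edge => //; left.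
  case/(in_tree_edge _ fr') => // -[j Ej].
  by move: fr; rewrite /fresh Ej eqxx.
have aux v v' a a' : a != a' -> fresh v a -> fresh v' a' ->
    tree_edge v a = tree_edge v' a' -> size (val v') = (size (val v)).+1.
  move=> naa fv fv' Ev; set c := tree_child v a (Ordinal k0).
  have : c \in tree_edge v' a'.
    rewrite -Ev; apply/in_tree_edge => //; right; exists (Ordinal k0).
    exact: val_tree_child.
  case/(in_tree_edge _ fv') => [<-|[j]]; first by rewrite val_tree_child.
  by rewrite val_tree_child // => -[Ea]; rewrite Ea eqxx in naa.
have h1 := aux _ _ _ _ ne fr fr' E.
have h2 := aux u' u i' i; rewrite eq_sym in ne.
have : (size (val u) < size (val u'))%N by rewrite h1.
by rewrite ltnNge (h2 ne fr' fr (esym E)) leqnSn.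
Qed.

Lemma hypertree_uniform : uniform (hypertree k d) k.+1.
Proof.
move=> _ [u [i [fr ->]]]; rewrite /tree_edge cardfsU1 card_imfset /=; last first.
  by move=> j j' /(congr1 val); rewrite !val_tree_child // => -[].
rewrite -cardE card_ord.
suff -> : u \notin [fset tree_child u i j | j : 'I_k] by rewrite add1n.
apply/imfsetP => -[j _ /(congr1 (size \o val))] /=.
by rewrite val_tree_child //=; exact: n_Sn.
Qed.

Let base w i : tree_vertex k d :=
  if fresh w i then w else insubd w (behead (val w)).

Lemma base_spec w i : fresh (base w i) i /\ w \in tree_edge (base w i) i.
Proof.
rewrite /base; case: ifPn => fr.
  by split=> //; apply/in_tree_edge => //; left.
case: w fr => -[|[i' j] s] rs //; rewrite /fresh /= negbK => /eqP [Ei].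
subst i'; have rs' : reduced s by move: rs; rewrite /reduced /= => /path_sorted.
set b := insubd _ s; have Eb : val b = s by rewrite val_insubd rs'.
have fb : fresh b i.
  rewrite /fresh Eb; move: (rs); case: (s) => [|[i' j'] s'] //=.
  by rewrite /reduced /= => /andP[ne _]; apply: contra ne => /eqP[->].
split; first exact: fb.
by apply/in_tree_edge => //; right; exists j; rewrite Eb.
Qed.

Lemma in_tree_edge_base w u i : fresh u i -> w \in tree_edge u i -> u = base w i.
Proof.
move=> fr /(in_tree_edge _ fr)[->|[j Ej]]; first by rewrite /base fr.
rewrite /base {1}/fresh Ej /= eqxx /=; apply: val_inj.
by rewrite val_insubd ifT //; exact: valP.
Qed.

Lemma hypertree_regular : (0 < k)%N -> regular (hypertree k d) d.+1.
Proof.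
move=> k0 w; rewrite (card_eqr card_II).
have -> : star (hypertree k d) w =
    [set tree_edge (base w i) i | i in [set: 'I_d.+1]]%classic.
  apply/seteqP; split=> e /=.
    by case=> -[u [i [fr ->]]] we; exists i; rewrite // -(in_tree_edge_base fr we).
  by case=> i _ <-; have [fr we] := base_spec w i; split=> //; exists (base w i), i.
apply: inj_card_eq => i i' _ _ /tree_edge_inj; case=> //; exact: (base_spec _ _).1.
Qed.

Local Notation inc := (incident (hypertree k d)).
Local Notation nodeT := (tree_vertex k d + {fset tree_vertex k d})%type.

Lemma incident_sym (x y : nodeT) : inc x y = inc y x.
Proof. by case: x y => [x|x] [y|y]. Qed.

Let lev (x : nodeT) : nat :=
  match x with
  | inl w => (size (val w)).*2
  | inr e => (\max_(w <- e) (size (val w)).*2).-1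
  end.

Lemma lev_edge u i : (0 < k)%N -> fresh u i ->
  lev (inr (tree_edge u i)) = (size (val u)).*2.+1.
Proof.
move=> k0 fr /=; suff -> : (\max_(w <- tree_edge u i) (size (val w)).*2 =
  (size (val u)).*2.+2)%N by [].
apply/eqP; rewrite eqn_leq; apply/andP; split.
  apply/bigmax_leqP_seq => w /(in_tree_edge _ fr)[->|[j ->]] _ //=.
  by rewrite -addn2 leq_addr.
set c := tree_child u i (Ordinal k0).
have cE : c \in tree_edge u i.
  apply/in_tree_edge => //; right; exists (Ordinal k0); exact: val_tree_child.
have -> : (size (val u)).*2.+2 = (size (val c)).*2 by rewrite val_tree_child.
exact: (@leq_bigmax_seq _ _ _ (fun w : tree_vertex k d => (size (val w)).*2)).
Qed.

Lemma lev_neq (x y : nodeT) : (0 < k)%N -> inc x y -> lev x != lev y.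
Proof.
move=> k0; wlog: x y / if x is inl _ then true else false.
  move=> wl; case: x y => [w|e] [w'|e'] //; first exact: wl.
  by rewrite incident_sym eq_sym => h; exact: wl.
case: x y => [w|//] [//|e] _ /andP[/asboolP[u [i [fr ->]]] _].
rewrite lev_edge //; apply/eqP => /(congr1 odd) /=.
by rewrite !odd_double.
Qed.

Lemma lev_parent (x y z : nodeT) : (0 < k)%N -> inc x y -> inc x z ->
  (lev y < lev x)%N -> (lev z < lev x)%N -> y = z.
Proof.
move=> k0; case: x y z => [w|e] [w1|e1] // [w2|e2] //.
  case/andP=> /asboolP[u [i [fr ->]]] we /andP[/asboolP[u' [i' [fr' ->]]] we'].
  rewrite !lev_edge //= => l l'; congr inr.
  case: (in_tree_edge _ fr we) l => [->|[j E]] l.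
    by rewrite ltnNge leqnSn in l.
  case: (in_tree_edge _ fr' we') l' => [->|[j' E']] l'.
    by rewrite ltnNge leqnSn in l'.
  by move: E'; rewrite E => -[-> _ /val_inj ->].
case/andP=> /asboolP[u [i [fr ->]]] w1e /andP[_ w2e].
have low v : v \in tree_edge u i ->
    (lev (inl v) < lev (inr (tree_edge u i)))%N -> v = u.
  move=> ve; rewrite lev_edge //; case: (in_tree_edge _ fr ve) => // -[j E].
  by rewrite /= E /= doubleS ltnNge leqnSn.
by move=> l1 l2; congr inl; rewrite (low _ w1e l1) (low _ w2e l2).
Qed.

Lemma hypertree_acyclic (c : seq nodeT) : (0 < k)%N ->
  (2 < size c)%N -> uniq c -> ~~ cycle inc c.
Proof.
move=> k0 sc uc; apply/negP => cc.
have [x xc xmax] : exists2 x, x \in c & forall y, y \in c -> (lev y <= lev x)%N.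
  elim: c sc {uc cc} => // a [|b c] IH _.
    by exists a; rewrite ?mem_head // => y; rewrite inE => /eqP ->.
  have : exists2 x, x \in b :: c &
      forall y, y \in b :: c -> (lev y <= lev x)%N.
    elim: (c) b {IH} => [b|b' s IH b].
      by exists b; rewrite ?mem_head // => y; rewrite inE => /eqP ->.
    have [m ms mmax] := IH b'; have [l|l] := leqP (lev b) (lev m).
      exists m; rewrite ?inE ?ms ?orbT //; first by rewrite -in_cons ms orbT.
      by move=> y; rewrite inE => /orP[/eqP->//|/mmax].
    exists b; rewrite ?mem_head // => y; rewrite inE => /orP[/eqP->//|/mmax].
    by move=> h; apply: leq_trans h (ltnW l).
  case=> m ms mmax; have [l|l] := leqP (lev a) (lev m).
    exists m; first by rewrite in_cons ms orbT.
    by move=> y; rewrite inE => /orP[/eqP->//|/mmax].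
  exists a; rewrite ?mem_head // => y; rewrite inE => /orP[/eqP->//|/mmax].
  by move=> h; apply: leq_trans h (ltnW l).
have [n p Ec] := rot_to xc.
have {}cc : cycle inc (x :: p) by rewrite -Ec rot_cycle.
have {}uc : uniq (x :: p) by rewrite -Ec rot_uniq.
have {}sc : (2 < size (x :: p))%N by rewrite -Ec size_rot.
have {xc} xm y : y \in x :: p -> (lev y <= lev x)%N by rewrite -Ec mem_rot; apply: xmax.
case: p cc uc sc xm {Ec} => // y p; case/lastP: p => // p z cc uc _ xm.
move: cc; rewrite /cycle rcons_path /= last_rcons => /andP[/andP[xy _] zx].
have lt a : inc x a -> a \in x :: y :: rcons p z -> (lev a < lev x)%N.
  by move=> xa ain; rewrite ltn_neqAle xm // andbT eq_sym lev_neq.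
have yz : y = z.
  rewrite incident_sym in zx; apply: (lev_parent k0 xy zx); apply: lt => //.
    by rewrite !inE eqxx orbT.
  by rewrite !inE mem_rcons mem_head !orbT.
by move: uc; rewrite yz /= mem_rcons mem_head /= andbF.
Qed.

Let conn (x y : nodeT) := exists p, path inc x p /\ last x p = y.

Lemma conn_trans x y z : conn x y -> conn y z -> conn x z.
Proof.
move=> [p [pp pl]] [q [qp ql]]; exists (p ++ q).
by rewrite cat_path last_cat pl pp qp ql.
Qed.

Lemma conn_sym x y : conn x y -> conn y x.
Proof.
move=> [p [pp pl]]; exists (rev (belast x p)); split.
  rewrite -pl rev_path; rewrite (eq_path (e' := inc)) // => a b.
  exact: incident_sym.
by case: p pl {pp} => //= a p _; rewrite rev_cons last_rcons.
Qed.

Let root : tree_vertex k d := exist _ [::] isT.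

Lemma conn_edge u i : fresh u i -> conn (inr (tree_edge u i)) (inl u).
Proof.
move=> fr; exists [:: inl u]; split=> //=; rewrite andbT; apply/andP; split.
  by apply/asboolP; exists u, i.
by apply/in_tree_edge => //; left.
Qed.

Lemma conn_root (x : nodeT) : node (hypertree k d) x -> conn x (inl root).
Proof.
have vert u : conn (inl u) (inl root).
  have [n] := ubnP (size (val u)); elim: n u => // n IH u.
  case Eu : (val u) => [|[i j] s] su.
    by exists [::]; split=> //=; congr inl; apply: val_inj.
  have [fr ue] := base_spec u i; set b := base u i in fr ue.
  have Eb : val u = (i, j) :: val b.
    case: (in_tree_edge _ fr ue) => [ub|[j' E]].
      by move: fr; rewrite -ub /fresh Eu eqxx.
    by move: E; rewrite Eu => -[-> ->].
  apply: (@conn_trans _ (inr (tree_edge b i))).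
    exists [:: inr (tree_edge b i)]; split=> //=; rewrite andbT ue andbT.
    by apply/asboolP; exists b, i.
  apply: conn_trans (conn_edge fr) (IH _ _).
  by move: su; rewrite -Eu Eb.
case: x => [u _|e [u [i [fr ->]]]]; first exact: vert.
exact: conn_trans (conn_edge fr) (vert u).
Qed.

Lemma hypertreeP : (0 < k)%N ->
  [/\ uniform (hypertree k d) k.+1, regular (hypertree k d) d.+1
     & incidence_tree (hypertree k d)].
Proof.
move=> k0; split; [exact: hypertree_uniform | exact: hypertree_regular | split].
  move=> x y nx ny; apply: conn_trans (conn_root nx) (conn_sym (conn_root ny)).
by move=> c; exact: hypertree_acyclic.
Qed.

End HypertreeTheory.

(* Main.v *)
(* The neighbours of a vertex v form at most d + 1 cliques, one per hyperedge.
   Removing them clique by clique expresses the ratio P(v in I) / P(v notin I)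
   as lambda times the product over these cliques of 1 / (1 + sum_u ratio(u)),
   where ratio(u) is taken in the hypergraph without v, the earlier cliques and
   the rest of u's own clique, so that u has at most d hyperedges left.
   Unfolding this recursion gives a finite vertex set Psi of the hypertree with
   a labelling Psi -> V for which the ratio at the root obeys the same recursion.
   Boundary conditions lift along the labelling. As ratios are not defined under
   occupied pins, the identity is proved for activities in the fraction field of
   {poly R}, a pinned vertex having activity 0 or lambda 'X, and then top
   coefficients are compared. Geodesics from v also lift, so the distance to the
   disagreement set is exactly preserved and delta need not be monotone. *)

Require Import Defs.
From HB Require Import structures.
From mathcomp Require Import all_boot all_order all_algebra.
From mathcomp Require Import finmap boolp classical_sets functions cardinality.
From mathcomp Require Import reals.

Set Implicit Arguments.
Unset Strict Implicit.
Unset Printing Implicit Defensive.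

Import Order.TTheory GRing.Theory Num.Theory.

Local Open Scope classical_set_scope.
Local Open Scope ring_scope.
Local Open Scope fset_scope.

(** * Adjacency as a relation, and independence in terms of it *)

Definition adj (V : choiceType) (H : hypergraph V) : rel V :=
  fun u v => `[< adjacent H u v >].

Section Adjacency.
Variables (V : choiceType) (H : hypergraph V).

Lemma adj_edge (e : {fset V}) (u v : V) :
  H e -> u \in e -> v \in e -> u != v -> adj H u v.
Proof. by move=> He ue ve uv; apply/asboolP; split=> //; exists e. Qed.

Lemma adj_sym : symmetric (adj H).
Proof.
move=> u v; apply/asboolP/asboolP => -[uv [e [He ue ve]]];
  by split; [rewrite eq_sym | exists e].
Qed.

Lemma adj_irr (u : V) : adj H u u = false.
Proof. by apply/asboolP => -[/eqP]. Qed.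

(** Two distinct vertices of [I] in one hyperedge form an adjacent pair, so independence depends
    only on the adjacency graph. *)
Lemma independentP (I : {fset V}) :
  independent H I <-> {in I &, forall u v, ~~ adj H u v}.
Proof.
split=> [ind u v uI vI|ind e He].
  apply/asboolP => -[uv [e [He ue ve]]]; have := ind e He.
  rewrite leqNgt => /negP; apply.
  have <- : #|` [fset u; v]| = 2%N by rewrite cardfs2 uv.
  apply: fsubset_leq_card; apply/fsubsetP => x.
  by rewrite !inE => /orP[] /eqP ->; rewrite ?uI ?vI ?ue ?ve.
rewrite leqNgt; apply/negP => gt1.
have [u uIe] : exists u, u \in I `&` e.
  by apply/fset0Pn; rewrite -cardfs_gt0; apply: ltn_trans gt1.
move: gt1; rewrite (cardfsD1 u) uIe add1n ltnS cardfs_gt0 => /fset0Pn[v].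
move: uIe; rewrite !inE => /andP[uI ue] /and3P[vu vI ve].
by have /negP[] := ind _ _ vI uI; apply: (adj_edge He).
Qed.

End Adjacency.

(** * Deletion recursions for the independence polynomial *)

Section IndependencePolynomial.
Local Open Scope ring_scope.
Variables (V : choiceType) (H : hypergraph V) (S : comNzRingType) (w : V -> S).
Implicit Types (U I : {fset V}) (v : V).

(** The multivariate independence polynomial of the adjacency graph induced on [U]. The ring is left
    general because both [{poly R}] and its fraction field are needed. *)
Definition indpoly U : S := \sum_(I <- indsets H U) \prod_(u <- I) w u.

Definition link v U : {fset V} := [fset x in U | (x != v) && ~~ adj H v x].

Lemma in_link v U x : (x \in link v U) = [&& x \in U, x != v & ~~ adj H v x].
Proof. by rewrite !inE. Qed.

Lemma in_indsets U I :
  reflect (I `<=` U /\ {in I &, forall u v, ~~ adj H u v}) (I \in indsets H U).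
Proof.
rewrite !inE /= fpowersetE; apply: (iffP andP) => -[IU].
  by move/asboolP/independentP.
by move=> ind; split=> //; apply/asboolP/independentP.
Qed.

Lemma indpoly_out v U :
  \sum_(I <- indsets H U | v \notin I) \prod_(u <- I) w u = indpoly (U `\ v).
Proof.
rewrite /indpoly big_fset_condE; congr (\sum_(I <- enum_fset _) _).
apply/fsetP => I; rewrite !inE /=; apply/idP/idP.
  case/andP=> /andP[]; rewrite !fpowersetE => /fsubsetP IU ind vI.
  rewrite ind andbT; apply/fsubsetP => x xI; rewrite !inE IU // andbT.
  by apply: contraNneq vI => <-.
case/andP; rewrite !fpowersetE => /fsubsetP IU ind; rewrite ind andbT.
apply/andP; split.
  by apply/fsubsetP => x /IU; rewrite !inE => /andP[].
by apply/negP => /IU; rewrite !inE eqxx.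
Qed.

Lemma indpoly_in v U : v \in U ->
  \sum_(I <- indsets H U | v \in I) \prod_(u <- I) w u = w v * indpoly (link v U).
Proof.
move=> vU; rewrite /indpoly big_fset_condE big_distrr /=.
have -> : [fset I in indsets H U | v \in I] =
    [fset v |` I | I in indsets H (link v U)].
  apply/fsetP => I; rewrite in_fset inE; apply/idP/imfsetP.
    case/andP=> /in_indsets[/fsubsetP IU ind] vI.
    exists (I `\ v); last by rewrite /= fsetD1K.
    apply/in_indsets; split.
      apply/fsubsetP => x; rewrite !inE => /andP[xv xI].
      by rewrite IU // xv ind.
    by move=> x y; rewrite !inE => /andP[_ xI] /andP[_ yI]; apply: ind.
  case=> J /= /in_indsets[/fsubsetP JU ind] ->; rewrite fset1U1 andbT.
  apply/in_indsets; split.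
    apply/fsubsetP => x; rewrite !inE => /orP[/eqP -> //|/JU].
    by rewrite !inE => /andP[].
  move=> x y; rewrite !inE => /orP[/eqP ->|xJ] /orP[/eqP ->|yJ].
  - by rewrite adj_irr.
  - by have := JU _ yJ; rewrite !inE => /and3P[].
  - by rewrite adj_sym; have := JU _ xJ; rewrite !inE => /and3P[].
  - exact: ind.
have vN I : I \in indsets H (link v U) -> v \notin I.
  by move=> /in_indsets[/fsubsetP IU _]; apply/negP => /IU; rewrite !inE eqxx andbF.
rewrite big_imfset /=; last first.
  move=> I J /vN vI /vN vJ E; apply/fsetP => x; have /fsetP/(_ x) := E.
  by rewrite !inE; case: eqP => // -> _; rewrite (negPf vI) (negPf vJ).
by apply: eq_big_seq => I /vN vI; rewrite big_fsetU1.
Qed.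

Lemma indpoly_split v U : v \in U ->
  indpoly U = w v * indpoly (link v U) + indpoly (U `\ v).
Proof.
move=> vU; rewrite -indpoly_in // -indpoly_out /indpoly.
by rewrite (bigID (fun I : {fset V} => v \in I)).
Qed.

(* At most one vertex [u] of a clique [C] is occupied; deleting the rest of [C]
   then changes nothing, since it is contained in the neighbourhood of [u]. *)
Lemma indpoly_clique (C U : {fset V}) :
  C `<=` U -> {in C &, forall x y, x != y -> adj H x y} ->
  indpoly U = indpoly (U `\` C) +
    \sum_(u <- C) w u * indpoly (link u (U `\` (C `\ u))).
Proof.
move=> CU cl.
have -> : \sum_(u <- C) w u * indpoly (link u (U `\` (C `\ u))) =
          \sum_(u <- C) w u * indpoly (link u U).
  apply: eq_big_seq => u uC; congr (w u * indpoly _).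
  apply/fsetP => x; rewrite !inE.
  have [->|xu] := eqVneq x u; first by rewrite !andbF.
  have [xC|xC] := boolP (x \in C); last by [].
  by rewrite (cl u x) ?andbF // eq_sym.
elim/fset1U_rect: C U CU cl => [|u C uC IH] U /fsubsetP CU cl.
  by rewrite big_seq_fset0 fsetD0 addr0.
have uU : u \in U by apply: CU; rewrite fset1U1.
rewrite (indpoly_split uU) big_fsetU1 //= [RHS]addrCA; congr (_ + _).
have -> : U `\` (u |` C) = (U `\ u) `\` C.
  by apply/fsetP => x; rewrite !inE negb_or andbCA andbA.
rewrite IH; first congr (_ + _).
- apply: eq_big_seq => x xC; congr (w x * indpoly _).
  apply/fsetP => y; rewrite !inE; have [->|yu] //= := eqVneq y u.
  rewrite cl ?andbF ?inE ?xC ?eqxx ?orbT //.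
  by apply: contraNneq uC => <-.
- apply/fsubsetP => x xC; rewrite !inE CU ?andbT; last by rewrite !inE xC orbT.
  by apply: contraNneq uC => <-.
- by move=> x y xC yC; apply: cl; rewrite !inE ?xC ?yC orbT.
Qed.

End IndependencePolynomial.

(** * Peeling off the neighbours of a vertex *)

Section Layers.
Variables (V : choiceType) (m : nat).
Implicit Types (U : {fset V}) (E : 'I_m -> pred V).

(* The sets E i cover the neighbours of v, which are removed layer by layer;
   [descent v U E i u] is what is left when u, in the i-th layer, takes over. *)
Definition residual (v : V) U E (n : nat) : {fset V} :=
  [fset x in U | (x != v) && [forall i : 'I_m, (i < n)%N ==> ~~ E i x]].

Definition layer (v : V) U E (i : 'I_m) : {fset V} :=
  [fset x in residual v U E i | E i x].

Definition descent (v : V) U E (i : 'I_m) (u : V) : {fset V} :=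
  residual v U E i `\` (layer v U E i `\ u).

Lemma in_residual v U E n x :
  reflect [/\ x \in U, x != v & forall i : 'I_m, (i < n)%N -> ~~ E i x]
          (x \in residual v U E n).
Proof.
rewrite !inE; apply: (iffP and3P) => -[xU xv /= nE]; split=> //.
  by move=> i lt; apply: (implyP (forallP nE i)).
by apply/forallP => i; apply/implyP/nE.
Qed.

Lemma in_layer v U E i x :
  (x \in layer v U E i) = (x \in residual v U E i) && E i x.
Proof. by rewrite in_fset. Qed.

Lemma in_descent v U E i u x :
  (x \in descent v U E i u) =
  (x \in residual v U E i) && ((x == u) || ~~ E i x).
Proof.
rewrite !in_fsetD in_layer in_fset1 !negb_and negbK.
by case: (x \in residual _ _ _ _); rewrite /= ?andbF ?andbT.
Qed.

Lemma layerW v U E i x : x \in layer v U E i -> [/\ x \in U, x != v & E i x].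
Proof. by rewrite in_layer => /andP[/in_residual[]]. Qed.

Lemma descentW v U E i u x : x \in descent v U E i u -> x \in U /\ x != v.
Proof. by rewrite in_descent => /andP[/in_residual[]]. Qed.

Lemma mem_descent v U E i u : u \in layer v U E i -> u \in descent v U E i u.
Proof. by rewrite in_descent in_layer eqxx => /andP[-> _]. Qed.

Lemma residual0 v U E : residual v U E 0 = U `\ v.
Proof.
apply/fsetP => x; rewrite in_fsetD1; apply/in_residual/andP => [[]|[]] //.
Qed.

Lemma residualS v U E (i : 'I_m) :
  residual v U E i.+1 = residual v U E i `\` layer v U E i.
Proof.
apply/fsetP => x; rewrite in_fsetD in_layer.
apply/in_residual/andP => [[xU xv nE]|[]].
  split; first by rewrite negb_and (nE i) ?orbT.
  by apply/in_residual; split=> // j ji; apply/nE/ltnW.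
rewrite negb_and => /orP[/negPf -> //|nEi] /in_residual[xU xv nE]; split=> //.
move=> j; rewrite ltnS leq_eqVlt => /orP[/eqP /val_inj -> //|]; exact: nE.
Qed.

(** The denominator of the ratio at [u] is thus the same for every [u] of a layer, so the ratios of
    one layer can be summed. *)
Lemma descent_root v U E i u :
  u \in layer v U E i -> descent v U E i u `\ u = residual v U E i.+1.
Proof.
move=> uL; rewrite residualS; apply/fsetP => x.
rewrite in_fsetD1 /descent in_fsetD in_fsetD1 in_fsetD.
by have [->|xu] := eqVneq x u; rewrite ?uL.
Qed.

End Layers.

(** * The recursion for occupation ratios *)

Section Ratio.
Local Open Scope ring_scope.
Variables (V : choiceType) (H : hypergraph V) (F : fieldType) (w : V -> F).

Definition occ_ratio (v : V) (U : {fset V}) : F :=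
  w v * indpoly H w (link H v U) / indpoly H w (U `\ v).

Hypothesis indpoly_neq0 : forall U, indpoly H w U != 0.

(* Deleting the neighbours of v clique by clique writes [indpoly (U `\ v)] over
   [indpoly (link v U)] as a telescoping product. *)
Lemma occ_ratio_rec (m : nat) (E : 'I_m.+1 -> pred V) (v : V) (U : {fset V}) :
  (forall i, {in E i &, forall x y, x != y -> adj H x y}) ->
  (forall x, x \in U -> x != v -> adj H v x = [exists i, E i x]) ->
  occ_ratio v U = w v *
    \prod_(i < m.+1) (1 + \sum_(u <- layer v U E i) occ_ratio u (descent v U E i u))^-1.
Proof.
move=> clique cover; rewrite /occ_ratio -mulrA; congr (_ * _).
have -> : link H v U = residual v U E m.+1.
  apply/fsetP => x; rewrite in_link; apply/and3P/in_residual => -[xU xv].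
    by rewrite cover // negb_exists => /forallP nE; split.
  move=> nE; split=> //; rewrite cover // negb_exists.
  by apply/forallP => i; apply: nE.
rewrite -(residual0 v U E) -(telescope_prodf (f := fun n => indpoly H w (residual v U E n))) //.
rewrite big_mkord; apply: eq_bigr => i _.
(* The inverse of each factor is the clique expansion divided by the polynomial of the next
   residual, which is 1 plus the sum of the ratios. *)
rewrite (indpoly_clique (H := H) w (C := layer v U E i) (U := residual v U E i)).
- rewrite -residualS -invf_div; congr (_^-1).
  rewrite mulrDl divff // mulr_suml; congr (1 + _).
  apply: eq_big_seq => u uL; rewrite descent_root //.
- by apply/fsubsetP => x; rewrite in_layer => /andP[].
- move=> x y /layerW[_ _ xE] /layerW[_ _ yE]; exact: (clique i).
Qed.

End Ratio.

(** * Parents, children and siblings in the hypertree *)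

Section HypertreeAdjacency.
Variables k d : nat.
Implicit Types (x y : tree_vertex k d).

Lemma child_fresh x y i j :
  val y = (i, j) :: val x -> ohead (unzip1 (val x)) != Some i.
Proof.
case: x y => [[|[i' j'] s] rs] [t rt] //= E; move: rt; rewrite E /reduced /=.
by case/andP=> ne _; apply: contra ne => /eqP[->].
Qed.

Lemma parent_exists y i j (s : seq ('I_d.+1 * 'I_k)) :
  val y = (i, j) :: s -> exists x, val x = s.
Proof.
case: y => t rt /= E; have rs : reduced s by move: rt; rewrite E => /path_sorted.
by exists (exist _ s rs).
Qed.

Lemma adj_child x y i j : val y = (i, j) :: val x -> adj (hypertree k d) x y.
Proof.
move=> E; have fr := child_fresh E; apply: (@adj_edge _ _ (tree_edge x i)).
- by exists x, i.
- by apply/(in_tree_edge _ fr); left.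
- by apply/(in_tree_edge _ fr); right; exists j.
- by apply/eqP => xy; have := congr1 size E; rewrite xy /= => /n_Sn.
Qed.

Lemma adj_siblings x y i j j' (s : seq ('I_d.+1 * 'I_k)) :
  val x = (i, j) :: s -> val y = (i, j') :: s -> x != y ->
  adj (hypertree k d) x y.
Proof.
move=> Ex Ey; have [z Ez] := parent_exists Ex; subst s.
have fr := child_fresh Ex; apply: (@adj_edge _ _ (tree_edge z i)).
- by exists z, i.
- by apply/(in_tree_edge _ fr); right; exists j.
- by apply/(in_tree_edge _ fr); right; exists j'.
Qed.

Lemma adj_hypertree x y : adj (hypertree k d) x y ->
  [\/ exists i j, val y = (i, j) :: val x,
      exists i j, val x = (i, j) :: val y |
      exists i j j' (s : seq ('I_d.+1 * 'I_k)),
        val x = (i, j) :: s /\ val y = (i, j') :: s].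
Proof.
move=> /asboolP[xy [_ [[u [i [fr ->]]]]]].
case/(in_tree_edge _ fr) => [Ex|[j Ex]] /(in_tree_edge _ fr)[Ey|[j' Ey]].
- by rewrite Ex Ey eqxx in xy.
- by subst x; constructor 1; exists i, j'.
- by subst y; constructor 2; exists i, j.
- by constructor 3; exists i, j, j', (val u).
Qed.

Lemma tree_vertices_le (n : nat) :
  exists s : seq (tree_vertex k d), forall x, (size (val x) <= n)%N -> x \in s.
Proof.
exists (pmap insub (flatten [seq [seq val t | t <- enum {: m.-tuple ('I_d.+1 * 'I_k)}]
                            | m <- iota 0 n.+1])) => x le.
rewrite mem_pmap_sub; apply/flatten_mapP; exists (size (val x)).
  by rewrite mem_iota ltnS.
by apply/mapP; exists (in_tuple (val x)); rewrite ?mem_enum.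
Qed.

End HypertreeAdjacency.

(** * Walks and the distance to a set *)

Section Distance.
Variables (V : choiceType) (H : hypergraph V).

Lemma walkSr n (u v w : V) : walk H n u w -> adjacent H w v -> walk H n.+1 u v.
Proof.
elim: n u => [|n IH] u /=; first by move=> -> wv; exists v.
by case=> u' [uu' u'w] wv; exists u'; split=> //; apply: IH.
Qed.

Lemma walkSr_inv n (u v : V) : walk H n.+1 u v ->
  exists2 w, walk H n u w & adjacent H w v.
Proof.
elim: n u => [|n IH] u; first by case=> u' [uu' <-]; exists u.
case=> u' [uu' /IH[w u'w wv]]; exists w => //.
by exists u'.
Qed.

Lemma reachesP v (D : {fset V}) n :
  reflect (exists u, u \in D /\ walk H n v u) (reaches H v D n).
Proof. exact: asboolP. Qed.

(** The least length reaching [D] is attained at some [u], and minimality over all of [D] makes that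
    walk a geodesic to [u]. *)
Lemma geodesic v (D : {fset V}) n : reaches H v D n ->
  exists u m, [/\ u \in D, (m <= n)%N, walk H m v u
                & forall m', (m' < m)%N -> ~ walk H m' v u].
Proof.
move=> rn; have ex : exists n, reaches H v D n by exists n.
case: (ex_minnP ex) => m /reachesP[u [uD uw]] min; exists u, m; split=> //.
  exact: min.
move=> m' lt uw'; have : reaches H v D m' by apply/reachesP; exists u.
by move/min; rewrite leqNgt lt.
Qed.

End Distance.

(** Inequalities suffice: a walk may become shorter when it is moved to the other side, and the two
    minima still coincide. *)
Lemma eq_dist (V W : choiceType) (H : hypergraph V) (K : hypergraph W)
    v (D : {fset V}) w (E : {fset W}) :
  (forall n, reaches H v D n -> exists2 m, (m <= n)%N & reaches K w E m) ->
  (forall n, reaches K w E n -> exists2 m, (m <= n)%N & reaches H v D m) ->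
  dist H v D = dist K w E.
Proof.
move=> HK KH; rewrite /dist; case: pselect => exH; case: pselect => exK //.
- congr Some; case: ex_minnP => n rn minn; case: ex_minnP => m rm minm.
  have [m' m'n /minm le] := HK _ rn; have [n' n'm /minn le'] := KH _ rm.
  by apply/eqP; rewrite eqn_leq (leq_trans le' n'm) (leq_trans le m'n).
- by case: exK; have [n /HK[m _ rm]] := exH; exists m.
- by case: exH; have [n /KH[m _ rm]] := exK; exists m.
Qed.

(** * The unfolding of a finite hypergraph at a vertex *)

Section Unfolding.
Variables (V : finType) (H : hypergraph V) (k d : nat) (v0 : V).
Hypotheses (size_le : edge_size_le H k.+1) (deg_le : degree_le H d.+1).
Implicit Types (v u : V) (U : {fset V}) (i : 'I_d.+1) (j : 'I_k).

(* A vertex, the set of vertices still alive, and the colour of the hyperedge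
   through which the vertex was entered (None at the root). *)
Definition state : Type := (V * {fset V} * option 'I_d.+1)%type.

Definition alive_edges v U : seq {fset V} :=
  [seq e <- fset_set (star H v) | e `&` U != [fset v]].

Definition free_colours (c : option 'I_d.+1) : seq 'I_d.+1 :=
  [seq i <- enum 'I_d.+1 | Some i != c].

(* The hyperedges at v that still contain another alive vertex receive distinct
   colours other than c; through c nothing alive can be reached. *)
Definition block (st : state) i : {fset V} :=
  let: (v, U, c) := st in
  if Some i != c then nth fset0 (alive_edges v U) (index i (free_colours c))
  else fset0.

(** The invariant of the unfolding: the hyperedge by which [v] was entered holds no other alive
    vertex, so it is not in [alive_edges] and needs no colour. *)
Definition good (st : state) : Prop :=
  let: (v, U, c) := st in v \in U /\
  (c != None -> exists e, [/\ H e, v \in e & e `&` U = [fset v]]).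

Lemma mem_star v e : (e \in fset_set (star H v)) = `[< H e >] && (v \in e).
Proof.
rewrite in_fset_set; last exact: sub_finite_set (@finite_finset _ setT).
apply/idP/andP => [|[/asboolP He ve]]; last by rewrite inE.
by rewrite inE => -[He ve]; split=> //; apply/asboolP.
Qed.

Lemma blockP st i x : x \in block st i -> H (block st i) /\ st.1.1 \in block st i.
Proof.
case: st => [[v U] c] /=; case: ifP => // _.
set n := index _ _; have [le|lt] := leqP (size (alive_edges v U)) n.
  by rewrite nth_default.
move=> _; have := mem_nth fset0 lt; rewrite mem_filter mem_star.
by case/and3P=> _ /asboolP.
Qed.

(** At the root, [d.+1] colours serve at most [d.+1] hyperedges. Elsewhere one colour is forbidden,
    but the entering hyperedge lies in the star and is not alive, so at most [d] hyperedges
    remain. *)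
Lemma size_alive_edges v U c :
  good (v, U, c) -> (size (alive_edges v U) <= size (free_colours c))%N.
Proof.
have fin : finite_set (star H v) by apply: sub_finite_set (@finite_finset _ setT).
have le : (size (fset_set (star H v)) <= d.+1)%N.
  by apply: geq_card_fset_set; apply: deg_le.
case: c => [c|] /= [vU gc]; rewrite /alive_edges /free_colours; last first.
  rewrite [X in (_ <= size X)%N](all_filterP _) ?size_enum_ord; last exact/allP.
  by apply: leq_trans le; rewrite size_filter count_size.
have [//|e [He ve eU]] := gc.
rewrite size_filter size_filter.
have -> : count (fun i => Some i != Some c) (enum 'I_d.+1) = d.
  have := count_predC (pred1 c) (enum 'I_d.+1).
  rewrite (count_uniq_mem _ (enum_uniq _)) mem_enum size_enum_ord add1n => -[]; apply: etrans.
  exact: eq_count.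
rewrite -ltnS; apply: leq_trans le.
rewrite -[leqRHS](count_predC (fun e : {fset V} => e `&` U != [fset v])).
rewrite -[leqLHS]addn1 leq_add2l -has_count; apply/hasP; exists e.
  by rewrite mem_star ve andbT; apply/asboolP.
by rewrite /= eU eqxx.
Qed.

(** Every alive hyperedge has an index below the number of free colours, so the colouring loses
    none. *)
Lemma block_cover v U c x : good (v, U, c) -> x \in U -> x != v ->
  adj H v x = [exists i, x \in block (v, U, c) i].
Proof.
move=> g xU xv; apply/idP/existsP => [|[i xb]]; last first.
  have [Hb vb] := blockP xb; apply: (adj_edge Hb) => //.
  by rewrite eq_sym.
move=> /asboolP[_ [e [He ve xe]]].
have es : e \in alive_edges v U.
  rewrite mem_filter mem_star ve andbT; apply/andP; split; last exact/asboolP.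
  by apply: contra xv => /eqP/fsetP/(_ x); rewrite !inE xe xU => /esym.
have lt : (index e (alive_edges v U) < size (free_colours c))%N.
  by apply: leq_trans (size_alive_edges g); rewrite index_mem.
have i0 : 'I_d.+1 := ord0.
exists (nth i0 (free_colours c) (index e (alive_edges v U))) => /=.
have := mem_nth i0 lt; rewrite mem_filter => /andP[-> _].
by rewrite index_uniq ?nth_index // filter_uniq ?enum_uniq.
Qed.

Lemma block_clique st i :
  {in block st i &, forall x y, x != y -> adj H x y}.
Proof. by move=> x y xb yb; have [Hb _] := blockP xb; apply: adj_edge Hb xb yb. Qed.

Definition blocks (st : state) : 'I_d.+1 -> pred V := fun i x => x \in block st i.

(** Layers replace the blocks themselves so that a vertex in several blocks is a child for the least
    colour only. *)
Definition children (st : state) i : {fset V} := layer st.1.1 st.1.2 (blocks st) i.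

Definition enter (st : state) i u : state :=
  (u, descent st.1.1 st.1.2 (blocks st) i u, Some i).

Definition step (st : state) i j : option state :=
  if (j < size (children st i))%N then Some (enter st i (nth v0 (children st i) j))
  else None.

Lemma step_inj st i j j' st' :
  step st i j = Some st' -> step st i j' = Some st' -> j = j'.
Proof.
rewrite /step; case: ifP => // lt [<-]; case: ifP => // lt' [E _].
apply: val_inj; apply/eqP; rewrite /= eq_sym.
by rewrite -(nth_uniq v0 lt' lt) ?E ?eqxx ?fset_uniq.
Qed.

Lemma stepP st i j st' : step st i j = Some st' ->
  st'.1.1 \in children st i /\ st' = enter st i st'.1.1.
Proof. by rewrite /step; case: ifP => // lt [<-]; split=> //; apply: mem_nth. Qed.

(** A block has at most [k.+1] vertices, and the current vertex is one of them but not a child, so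
    [k] indices are enough. *)
Lemma step_ex st i u : u \in children st i ->
  exists j, step st i j = Some (enter st i u).
Proof.
move=> uc; have lt : (index u (children st i) < k)%N.
  have [_ _ ub] := layerW uc; have [Hb vb] := blockP ub.
  have := size_le Hb; rewrite (cardfsD1 st.1.1) vb add1n ltnS; apply: leq_trans.
  apply: leq_trans (_ : size (children st i) <= _)%N; first by rewrite index_mem.
  apply: fsubset_leq_card; apply/fsubsetP => x /layerW[_ xv xb].
  by rewrite in_fsetD1 xv.
by exists (Ordinal lt); rewrite /step /= index_mem uc nth_index.
Qed.

(** From the block by which [u] is entered, [descent] keeps [u] alone. *)
Lemma enter_good st i u : u \in children st i -> good (enter st i u).
Proof.
move=> uc; split; first exact: mem_descent.
move=> _; exists (block st i); have [_ _ ub] := layerW uc.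
have [Hb _] := blockP ub; split=> //; apply/fsetP => x.
rewrite in_fsetI in_fset1 in_descent; have [->|xu] /= := eqVneq x u.
  by rewrite (ub : _ \in _); move: uc; rewrite in_layer => /andP[->].
by rewrite /blocks; case: (x \in block st i); rewrite ?andbF.
Qed.

Lemma enter_card st i u : good st -> u \in children st i ->
  (#|` (enter st i u).1.2| < #|` st.1.2|)%N.
Proof.
case: st => [[v U] c] [vU _] uc /=; rewrite [ltnRHS](cardfsD1 v) vU add1n ltnS.
apply: fsubset_leq_card; apply/fsubsetP => x /descentW[xU xv].
by rewrite in_fsetD1 xv.
Qed.

Lemma step_colour st i j : step st i j != None -> Some i != st.2.
Proof.
case E : (step st i j) => [st'|//] _; have [/layerW[_ _]] := stepP E.
by rewrite /blocks; case: st {E} => [[v U] c] /=; case: ifP.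
Qed.

Definition root_state : state := (v0, [fset v | v : V], None).

Fixpoint walk_state (p : seq ('I_d.+1 * 'I_k)) : option state :=
  if p is (i, j) :: q then obind (fun st => step st i j) (walk_state q)
  else Some root_state.

Lemma walk_state_cons i j q st' : walk_state ((i, j) :: q) = Some st' ->
  exists2 st, walk_state q = Some st & step st i j = Some st'.
Proof. by move=> /=; case: (walk_state q) => // st; exists st. Qed.

Lemma walk_state_colour p st :
  walk_state p = Some st -> st.2 = ohead (unzip1 p).
Proof.
case: p => [[<-] //|[i j] q /walk_state_cons[st' _ /stepP[_ ->]]] //.
Qed.

Lemma walk_state_good p st : walk_state p = Some st -> good st.
Proof.
case: p => [[<-] //=|[i j] q /walk_state_cons[st' _ /stepP[u ->]]].
  by split=> //; rewrite in_fset.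
exact: enter_good.
Qed.

(** Each step deletes at least the vertex being left. This bounds the depth of the unfolding and
    makes it finite. *)
Lemma walk_state_size p st :
  walk_state p = Some st -> (size p + #|` st.1.2| <= #|V|)%N.
Proof.
elim: p st => [|[i j] q IH] st.
  case=> <- /=; rewrite add0n card_imfset //=.
  by rewrite cardE.
case/walk_state_cons=> st' Eq Est; have := IH _ Eq; apply: leq_trans.
have [u ->] := stepP Est.
by rewrite addSnnS leq_add2l; apply: enter_card => //; apply: walk_state_good Eq.
Qed.

(** A state records the colour of the last step, and its block of that colour is empty. *)
Lemma walk_state_reduced p : walk_state p != None -> reduced p.
Proof.
elim: p => // -[i j] q IH.
case E : (walk_state _) => [st'|//] _; have [st Eq Est] := walk_state_cons E.
have rq : reduced q by apply: IH; rewrite Eq.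
have : Some i != st.2 by apply: (@step_colour _ _ j); rewrite Est.
rewrite (walk_state_colour Eq); case: q rq {IH E Eq} => //= -[i' j'] q rq ne.
by rewrite /reduced /= rq andbT; apply: contra ne => /eqP ->.
Qed.

Definition unfolds (x : tree_vertex k d) : bool := walk_state (val x) != None.

Definition label (x : tree_vertex k d) : V :=
  if walk_state (val x) is Some st then st.1.1 else v0.

Lemma unfolding_ex : exists Psi : {fset tree_vertex k d}, forall x, (x \in Psi) = unfolds x.
Proof.
have [s sP] := tree_vertices_le k d #|V|.
exists [fset x in s | unfolds x] => x; rewrite !inE /=.
apply/andP/idP => [[]//|ux]; split=> //; apply: sP.
move: ux; rewrite /unfolds; case E : walk_state => [st|//] _.
by apply: leq_trans (walk_state_size E); apply: leq_addr.
Qed.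

Implicit Types (x y z : tree_vertex k d).

Lemma unfolds_child x y i j st : walk_state (val x) = Some st ->
  val y = (i, j) :: val x -> unfolds y ->
  [/\ label y \in children st i, step st i j = Some (enter st i (label y))
    & walk_state (val y) = Some (enter st i (label y))].
Proof.
move=> Ex Ey; rewrite /unfolds /label; case E : walk_state => [st'|//] _.
move: E; rewrite Ey /= Ex /= => Est; have [uc Est'] := stepP Est.
by rewrite -Est'.
Qed.

Lemma unfolds_parent x y i j : val y = (i, j) :: val x -> unfolds y ->
  exists2 st, walk_state (val x) = Some st & label x = st.1.1.
Proof.
move=> Ey; rewrite /unfolds /label Ey.
case E : walk_state => [st'|//] _; have [st -> _] := walk_state_cons E.
by exists st.
Qed.

Lemma unfolding_child x i st u : walk_state (val x) = Some st ->
  u \in children st i ->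
  exists y j, [/\ val y = (i, j) :: val x, unfolds y & label y = u].
Proof.
move=> Ex /step_ex[j Ej].
have Ew : walk_state ((i, j) :: val x) = Some (enter st i u) by rewrite /= Ex.
have rw : reduced ((i, j) :: val x) by apply: walk_state_reduced; rewrite Ew.
by exists (exist _ ((i, j) :: val x) rw), j; split=> //; rewrite /unfolds /label /= Ex /= Ej.
Qed.

(** A block joins parent and child. Siblings share a block, and their labels differ because the
    enumeration of the children has no repetition. *)
Lemma label_adj x y : unfolds x -> unfolds y -> adj (hypertree k d) x y ->
  adj H (label x) (label y).
Proof.
have child_adj x' y' i j : val y' = (i, j) :: val x' -> unfolds y' ->
    adj H (label x') (label y').
  move=> Ey uy; have [st Ex ->] := unfolds_parent Ey uy.
  have [uc _ _] := unfolds_child Ex Ey uy; have [_ uv ub] := layerW uc.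
  have [Hb vb] := blockP ub; apply: (adj_edge Hb vb ub).
  by rewrite eq_sym.
move=> ux uy axy; case/adj_hypertree: (axy) => [[i [j Ey]]|[i [j Ex]]|].
- exact: child_adj Ey uy.
- by rewrite adj_sym; apply: child_adj Ex ux.
case=> i [j [j' [s [Ex Ey]]]]; have [z Ez] := parent_exists Ex; subst s.
have [st Es _] := unfolds_parent Ex ux.
have [xc stx _] := unfolds_child Es Ex ux; have [yc sty _] := unfolds_child Es Ey uy.
have [_ _ xb] := layerW xc; have [_ _ yb] := layerW yc.
apply: (block_clique xb yb); apply: contraTneq axy => E.
rewrite E in stx; have jj' := step_inj stx sty; subst j'.
by rewrite (val_inj (etrans Ex (esym Ey))) adj_irr.
Qed.

(** * Equality of the ratios in the tree and in the hypergraph *)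

Section RatioTransfer.
Local Open Scope ring_scope.
Variables (F : fieldType) (w : V -> F).
Let wT (x : tree_vertex k d) : F := w (label x).
Hypothesis neq0_H : forall U, indpoly H w U != 0.
Hypothesis neq0_T : forall X, indpoly (hypertree k d) wT X != 0.

(** Both sides obey the same recursion; the induction is on the number of alive vertices. [X] is
    prescribed only below [x] and may contain other vertices not adjacent to [x], since the set
    obtained for a child keeps other parts of the tree. *)
Lemma occ_ratio_unfolding (X : {fset tree_vertex k d}) x st :
  walk_state (val x) = Some st ->
  (forall y q, val y = q ++ val x -> (y \in X) = unfolds y) ->
  (forall y, y \in X -> adj (hypertree k d) x y ->
     exists i j, val y = (i, j) :: val x) ->
  occ_ratio (hypertree k d) wT x X = occ_ratio H w st.1.1 st.1.2.
Proof.
have [n] := ubnP #|` st.1.2|; elim: n => // n IH in X x st *.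
rewrite ltnS => card_st Ex below nbr.
pose E i y := [exists j : 'I_k, val y == (i, j) :: val x].
have EP i y : reflect (exists j, val y = (i, j) :: val x) (E i y).
  by apply: (iffP existsP) => -[j Ey]; exists j; apply/eqP.
have mem_layer i y : (y \in layer x X E i) = E i y && unfolds y.
  rewrite in_layer andbC; case: (EP i y) => [[j Ey]|_]; rewrite ?andTb ?andFb //.
  rewrite -(below y [:: (i, j)]) //; apply/in_residual/idP => [[]//|yX].
  split=> //; first by apply/eqP => yx; have := congr1 size Ey; rewrite yx => /n_Sn.
  move=> i' lt; apply/EP => -[j']; rewrite Ey => -[ii' _].
  by rewrite ii' ltnn in lt.
have layerP i y : y \in layer x X E i -> exists j,
    [/\ val y = (i, j) :: val x, label y \in children st i,
        step st i j = Some (enter st i (label y))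
      & walk_state (val y) = Some (enter st i (label y))].
  rewrite mem_layer => /andP[/EP[j Ey] uy]; exists j.
  by have [] := unfolds_child Ex Ey uy.
have gst := walk_state_good Ex.
rewrite (occ_ratio_rec neq0_T (E := E)); first last.
- move=> y yX yx; apply/idP/existsP => [axy|[i /EP[j Ey]]].
    by have [i [j Ey]] := nbr y yX axy; exists i; apply/EP; exists j.
  exact: adj_child Ey.
- by move=> i y z /EP[j Ey] /EP[j' Ez]; apply: adj_siblings Ey Ez.
rewrite (occ_ratio_rec neq0_H (E := blocks st)); first last.
- case: st gst {card_st Ex layerP} => [[v U] c] g u uU uv; exact: block_cover g uU uv.
- by move=> i u u'; apply: block_clique.
rewrite /wT /label Ex; congr (_ * _); apply: eq_bigr => i _; congr ((1 + _)^-1).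
(* [label] maps the tree layer bijectively onto the layer in [V], which matches the two sums term by
   term. *)
have -> : layer st.1.1 st.1.2 (blocks st) i = [fset label y | y in layer x X E i].
  apply/fsetP => u; apply/idP/imfsetP => [uc|[y /= /layerP[j [_ uc _ _]] -> //]].
  have [y [j [Ey uy <-]]] := unfolding_child Ex uc; exists y => //=.
  by rewrite mem_layer uy andbT; apply/EP; exists j.
rewrite [RHS]big_imfset; last first.
  move=> y y' yL y'L Eyy'; have [j [Ey _ Sy _]] := layerP _ _ yL.
  have [j' [Ey' _ Sy' _]] := layerP _ _ y'L.
  rewrite Eyy' in Sy; apply: val_inj.
  by rewrite Ey Ey' (step_inj Sy Sy').
apply: eq_big_seq => y yL; have [j [Ey yc _ Ewy]] := layerP _ _ yL.
rewrite (IH _ _ (enter st i (label y))) //.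
- exact: leq_trans (enter_card gst yc) card_st.
(* Only [x] and children of [x] other than [y] are deleted, and none of these is below [y]. *)
- move=> z q Ez; rewrite in_descent.
  have Ezx : val z = (q ++ [:: (i, j)]) ++ val x by rewrite -catA Ez Ey.
  have zE i' : E i' z -> z = y /\ i' = i.
    case/EP=> j'; rewrite Ez Ey => Eq.
    have /size0nil q0 : size q = 0%N.
      have := congr1 size Eq; rewrite size_cat /= addnS => -[].
      by move/eqP; rewrite -[X in _ == X]add0n eqn_add2r => /eqP.
    move: Eq Ez; rewrite q0 /= => -[-> _ ] /val_inj ->; by split.
  rewrite -(below z _ Ezx) andbC.
  have -> /= : (z == y) || ~~ E i z.
    by have [/zE[-> _]|] := boolP (E i z); rewrite ?eqxx ?orbT.
  apply/in_residual/idP => [[]//|zX]; split=> //.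
    apply/eqP => zx; have := congr1 size Ezx.
    rewrite zx size_cat size_cat addn1 addSn => /eqP.
    by rewrite -[X in X == _]add0n -addSn eqn_add2r.
  by move=> i' lt; apply/negP => /zE[_ ii']; rewrite ii' ltnn in lt.
(* The parent [x] and the siblings of [y] are gone, so the remaining neighbours of [y] are its
   children. *)
- move=> z; rewrite in_descent => /andP[/in_residual[zX zx _] zE] ayz.
  case/adj_hypertree: (ayz) => [//|[i' [j']]|].
    by rewrite Ey => -[_ _ /val_inj xz]; rewrite xz eqxx in zx.
  case=> i' [j1 [j2 [s []]]]; rewrite Ey => -[<- _ <-] Ez.
  have {}zE : z = y.
    by case/orP: zE => [/eqP //|/EP[]]; exists j2.
  by rewrite zE adj_irr in ayz.
Qed.

End RatioTransfer.

(** * Depth in the tree and distance in the hypergraph *)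

Definition tree_root : tree_vertex k d := exist _ [::] isT.

Lemma walk_tree_root x : walk (hypertree k d) (size (val x)) tree_root x.
Proof.
have [n En] : exists n, size (val x) = n by exists (size (val x)).
elim: n => [|n IH] in x En *.
  by rewrite En; apply: val_inj; rewrite /= (size0nil En).
case Ex : (val x) => [|[i j] s]; first by rewrite Ex in En.
have [y Ey] := parent_exists Ex; subst s.
have sy : size (val y) = n by move: En; rewrite Ex => -[].
by apply: walkSr (IH y sy) _; apply/asboolP; apply: adj_child Ex.
Qed.

Lemma walk_tree_size n x y :
  walk (hypertree k d) n x y -> (size (val y) <= n + size (val x))%N.
Proof.
elim: n x => [|n IH] x /=; first by move=> ->.
case=> z [/asboolP/adj_hypertree xz /IH]; move/leq_trans; apply.
rewrite addSnnS leq_add2l.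
case: xz => [[i [j ->]] //|[i [j ->]] /=|[i [j [j' [s [-> ->]]]]] /=].
  by rewrite ltnW // ltnS ltnW.
exact: leqnSn.
Qed.

Lemma walk_label x : unfolds x -> walk H (size (val x)) v0 (label x).
Proof.
have [n En] : exists n, size (val x) = n by exists (size (val x)).
elim: n => [|n IH] in x En * => ux.
  by rewrite En /label (size0nil En).
case Ex : (val x) => [|[i j] s]; first by rewrite Ex in En.
have [y Ey] := parent_exists Ex; subst s.
have sy : size (val y) = n by move: En; rewrite Ex => -[].
have [st Est _] := unfolds_parent Ex ux.
have uy : unfolds y by rewrite /unfolds Est.
apply: walkSr (IH y sy uy) _; apply/asboolP; apply: label_adj => //.
exact: adj_child Ex.
Qed.

(* A geodesic from v0 lifts: the vertices deleted along it are no farther from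
   v0 than its current end, so its next vertex is still alive. *)
Lemma lift_geodesic m u : walk H m v0 u ->
  (forall m', (m' < m)%N -> ~ walk H m' v0 u) ->
  exists x st, [/\ walk_state (val x) = Some st, size (val x) = m, label x = u
    & forall z : V, z \notin st.1.2 -> exists2 m', (m' <= m)%N & walk H m' v0 z].
Proof.
elim: m u => [|m IH] u.
  move=> <- _; exists tree_root, root_state; split=> // z /=.
  by rewrite in_fset.
case/walkSr_inv=> v wv vu min.
have [|x [st [Ex sx lx dead]]] := IH v wv.
  by move=> m' lt wv'; apply: (min m'.+1) => //; apply: walkSr wv' vu.
have Ev : st.1.1 = v by rewrite -lx /label Ex.
have uU : u \in st.1.2.
  by apply/negP => /negP/dead[m' le] /(min m'); apply; rewrite ltnS.
have uv : u != st.1.1 by rewrite Ev eq_sym; case: vu.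
have [i0 ui0] : exists i, u \in block st i.
  apply/existsP; have := walk_state_good Ex; case: st Ev uU uv {Ex dead} => [[v' U] c].
  move=> /= Ev uU uv g; rewrite -(block_cover g uU uv) Ev; exact/asboolP.
(* The least colour whose block contains [u] is the one whose layer contains [u]. *)
case: (@arg_minnP _ i0 (fun i => u \in block st i) (fun i => i : nat) ui0) => i ui mini.
have uc : u \in children st i.
  rewrite in_layer; apply/andP; split=> //; apply/in_residual; split=> //.
  by move=> i' lt; apply/negP => /mini; rewrite leqNgt lt.
have [y [j [Ey uy ly]]] := unfolding_child Ex uc.
have [_ _ Ewy] := unfolds_child Ex Ey uy.
exists y, (enter st i (label y)); split=> //; first by rewrite Ey /= sx.
have near i' (z : V) : z \in block st i' -> exists2 m', (m' <= m.+1)%N & walk H m' v0 z.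
  have [->|zv] := eqVneq z st.1.1; first by rewrite Ev; exists m.
  move=> zb; exists m.+1 => //; apply: walkSr wv _; apply/asboolP.
  by have [Hb vb] := blockP zb; rewrite -Ev; apply: (adj_edge Hb) => //; rewrite eq_sym.
move=> z; rewrite in_descent negb_and negb_or negbK => /orP[|/andP[_ /near //]].
have [zU|/dead[m' le wz _]] := boolP (z \in st.1.2); last first.
  by exists m' => //; apply: leqW.
have [->|zv] := eqVneq z st.1.1; first by rewrite Ev; exists m.
have [//|far] := pselect (exists2 m', (m' <= m.+1)%N & walk H m' v0 z).
by move=> /negP[]; apply/in_residual; split=> // i' _; apply/negP => /near.
Qed.

(** A root path maps to a walk of the same length, so the tree distance is not the smaller one; a
    lifted geodesic shows that it is not the larger one. *)
Lemma dist_unfolding (D : {fset V}) (DT : {fset tree_vertex k d}) :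
  (forall x, (x \in DT) = unfolds x && (label x \in D)) ->
  dist (hypertree k d) tree_root DT = dist H v0 D.
Proof.
move=> DTE; apply: eq_dist => n.
  case/reachesP=> x [+ wx]; rewrite DTE => /andP[ux lx].
  exists (size (val x)); first by have := walk_tree_size wx; rewrite addn0.
  by apply/reachesP; exists (label x); split=> //; apply: walk_label.
case/geodesic=> u [m [uD le wu min]]; exists m => //.
have [x [st [Ex sx lx _]]] := lift_geodesic wu min.
apply/reachesP; exists x; rewrite DTE /unfolds Ex lx uD; split=> //.
by rewrite -sx; apply: walk_tree_root.
Qed.

End Unfolding.

(** * Pinned marginals as quotients of top coefficients *)

Section Pinning.
Local Open Scope ring_scope.
Variables (R : realType) (lambda : R).
Hypothesis lambda_gt0 : 0 < lambda.

Lemma coef_top_mul (n m : nat) (p q : {poly R}) :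
  (size p <= n.+1)%N -> (size q <= m.+1)%N -> (p * q)`_(n + m) = p`_n * q`_m.
Proof.
move=> sp sq; have lt : (n < (n + m).+1)%N by rewrite ltnS leq_addr.
rewrite coefM (bigD1 (Ordinal lt)) //= addKn big1 ?addr0 // => i ne.
have [lti|] := ltnP n i; first by rewrite nth_default ?mul0r // (leq_trans sp).
rewrite leq_eqVlt => /orP[/eqP ein|lti].
  by move: ne; rewrite -val_eqE /= ein eqxx.
by rewrite [q`_ _]nth_default ?mulr0 // (leq_trans sq) // ltn_subRL ltn_add2r.
Qed.

Variables (V : choiceType) (H : hypergraph V).
Implicit Types (L U I : {fset V}) (sigma : V -> bool) (u v : V).

(* A pinned vertex gets activity 0 or lambda 'X; pinned marginals are then read
   off the top coefficients in 'X of independence polynomials. *)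
Definition pin L sigma u : {poly R} :=
  if u \in L then (if sigma u then lambda *: 'X else 0) else lambda%:P.

(** At 1 the empty set contributes 1 and every other set a nonnegative value. *)
Lemma indpoly_neq0 (p : V -> {poly R}) U :
  (forall u, 0 <= (p u).[1]) -> indpoly H p U != 0.
Proof.
move=> p_ge0; apply/eqP => /(congr1 (horner^~ 1)); rewrite horner0 => /eqP.
apply/negP; rewrite gt_eqF // horner_sum (big_fsetD1 fset0) /=; last first.
  by apply/in_indsets; split; [exact: fsub0set | move=> x y; rewrite inE].
rewrite big_seq_fset0 hornerC ltr_wpDr // sumr_ge0 // => I _.
by rewrite horner_prod prodr_ge0.
Qed.

Lemma eq_indpoly (S : comNzRingType) (w w' : V -> S) U :
  {in U, w =1 w'} -> indpoly H w U = indpoly H w' U.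
Proof.
move=> ww'; apply: eq_big_seq => I /in_indsets[/fsubsetP IU _].
by apply: eq_big_seq => u /IU /ww'.
Qed.

Lemma indpoly_tofrac (p : V -> {poly R}) U :
  indpoly H (fun u => FracField.tofrac (p u)) U = FracField.tofrac (indpoly H p U).
Proof.
rewrite /indpoly rmorph_sum; apply: eq_bigr => I _; by rewrite rmorph_prod.
Qed.

Lemma pin_ge0 L sigma u : 0 <= (pin L sigma u).[1].
Proof.
rewrite /pin; case: ifP => _; last by rewrite hornerC ltW.
by case: ifP => _; rewrite ?horner0 // hornerZ hornerX mulr1 ltW.
Qed.

(** Occupying a vertex pinned to 0 kills the product, and each occupied vertex pinned to 1 brings a
    factor ['X]. A nonzero product thus has maximal degree, the number of pins to 1, exactly when
    [I] obeys the pinning. *)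
Lemma prod_pin L sigma I : \prod_(u <- I) pin L sigma u =
  (if I `&` L `<=` occupied L sigma then lambda ^+ #|` I| else 0) *:
    'X^#|` I `&` occupied L sigma|.
Proof.
case: ifP => [/fsubsetP sub|/negP nsub].
  rewrite (eq_big_seq (fun u => lambda%:P * 'X^(u \in occupied L sigma))); last first.
    move=> u uI; rewrite /pin; have := sub u; rewrite !inE /= uI /=.
    case: (u \in L) => /=; last by rewrite mulr1.
    by case: (sigma u) => [_|/(_ isT)] //; rewrite mul_polyC.
  rewrite big_split /= big_const_seq count_predT iter_mulr_1 -mul_polyC polyC_exp.
  congr (_ * _); rewrite -expr_sum; congr ('X^_).
  transitivity (\sum_(u <- I | u \in occupied L sigma) 1)%N.
    by rewrite [RHS]big_mkcond; apply: eq_bigr => u _; case: (u \in _).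
  rewrite big_fset_condE sum1_size; congr (size (enum_fset _)).
  by apply/fsetP => u; rewrite !inE.
rewrite scale0r; have /existsP[[u /= uI]] : [exists u : I, ~~ ((val u \in L) ==> sigma (val u))].
  apply: contra_notT nsub; rewrite negb_exists => /forallP all_ok.
  apply/fsubsetP => u; rewrite !inE => /andP[uI uL].
  by have := all_ok [` uI]; rewrite /= uL negbK.
rewrite negb_imply => /andP[uL nsu].
by rewrite (big_fsetD1 u) //= /pin uL (negPf nsu) mul0r.
Qed.

Lemma size_prod_pin L sigma I :
  (size (\prod_(u <- I) pin L sigma u)%R <= #|` occupied L sigma|.+1)%N.
Proof.
rewrite prod_pin; apply: leq_trans (size_scale_leq _ _) _.
by rewrite size_polyXn ltnS fsubset_leq_card // fsubsetIr.
Qed.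

Lemma coef_prod_pin L sigma I :
  (\prod_(u <- I) pin L sigma u)`_#|` occupied L sigma| =
  if I `&` L == occupied L sigma then lambda ^+ #|` I| else 0.
Proof.
rewrite prod_pin coefZ coefXn; set O := occupied L sigma.
have OL : O `<=` L by apply/fsubsetP => u; rewrite !inE => /andP[].
have -> : (#|` O| == #|` I `&` O|) = (O `<=` I).
  rewrite eq_sym; apply/eqP/idP => [E|/fsetIidPr -> //].
  have /eqP <- : I `&` O == O by rewrite eqEfcard fsubsetIr E leqnn.
  exact: fsubsetIl.
have -> : (I `&` L == O) = (I `&` L `<=` O) && (O `<=` I).
  rewrite eqEfsubset; congr (_ && _).
  by rewrite fsubsetI OL andbT.
by case: ifP; case: (O `<=` I); rewrite ?mulr1 ?mulr0 ?mul0r.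
Qed.

Lemma coef_sum_pin L sigma U (P : pred {fset V}) :
  (\sum_(I <- indsets H U | P I) \prod_(u <- I) pin L sigma u)`_#|` occupied L sigma|
  = \sum_(I <- indsets H U | P I && (I `&` L == occupied L sigma)) lambda ^+ #|` I|.
Proof.
by rewrite coef_sum big_mkcondr; apply: eq_bigr => I _; rewrite coef_prod_pin.
Qed.

Lemma size_sum_pin L sigma U (P : pred {fset V}) :
  (size (\sum_(I <- indsets H U | P I) \prod_(u <- I) pin L sigma u)%R
     <= #|` occupied L sigma|.+1)%N.
Proof.
by apply: (leq_trans (size_sum _ _ _)); apply/bigmax_leqP_seq => I _ _; apply: size_prod_pin.
Qed.

Lemma gibbs_prE U (P : pred {fset V}) :
  gibbs_pr H lambda U P =
  (\sum_(I <- indsets H U | P I) lambda ^+ #|` I|) / partition_function H lambda U.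
Proof.
rewrite /gibbs_pr mulr_suml big_seq_cond [RHS]big_seq_cond.
by apply: eq_bigr => I /andP[IU _]; rewrite /gibbs IU.
Qed.

Lemma sum_weight_gt0 U (P : pred {fset V}) I :
  I \in indsets H U -> P I -> 0 < \sum_(J <- indsets H U | P J) lambda ^+ #|` J|.
Proof.
move=> IU PI; rewrite big_mkcond (big_fsetD1 I) //= PI ltr_wpDr ?exprn_gt0 //.
by apply: sumr_ge0 => J _; case: ifP => // _; rewrite exprn_ge0 // ltW.
Qed.

Lemma marginalE L sigma U v :
  marginal H lambda U L sigma v =
  (\sum_(I <- indsets H U | v \in I) \prod_(u <- I) pin L sigma u)`_#|` occupied L sigma|
  / (indpoly H (pin L sigma) U)`_#|` occupied L sigma|.
Proof.
rewrite /marginal /gibbs_cond_pr !gibbs_prE coef_sum_pin /indpoly coef_sum_pin /=.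
rewrite -mulf_div divff ?mulr1 //.
rewrite gt_eqF // invr_gt0; apply: (@sum_weight_gt0 _ xpredT fset0) => //.
by apply/in_indsets; split; [exact: fsub0set | move=> x y; rewrite inE].
Qed.

(** The set [occupied L sigma] is itself one of the sets counted. *)
Lemma coef_indpoly_gt0 L sigma U : L `<=` U -> independent H (occupied L sigma) ->
  0 < (indpoly H (pin L sigma) U)`_#|` occupied L sigma|.
Proof.
move=> /fsubsetP LU /independentP ind; rewrite coef_sum_pin.
have OL : occupied L sigma `<=` L by apply/fsubsetP => u; rewrite !inE => /andP[].
apply: (sum_weight_gt0 (I := occupied L sigma)).
  by apply/in_indsets; split=> //; apply/fsubsetP => u /(fsubsetP OL) /LU.
by rewrite /= (fsetIidPl OL).
Qed.

End Pinning.

(** Cross-multiplying the ratios gives a polynomial identity, whose top coefficients are compared.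
    The comparison is made with all sets as denominator: that top coefficient is positive, whereas
    the one of the sets avoiding [v] vanishes if [v] is pinned to 1. *)
Lemma marginal_transfer (R : realType) (lambda : R) (V W : choiceType)
    (H : hypergraph V) (K : hypergraph W) (U L : {fset V}) (X M : {fset W})
    (sigma : V -> bool) (tau : W -> bool) (v : V) (w : W) :
  (0 < lambda)%R -> v \in U -> w \in X -> L `<=` U -> M `<=` X ->
  independent H (occupied L sigma) -> independent K (occupied M tau) ->
  occ_ratio H (fun u => FracField.tofrac (pin lambda L sigma u))%R v U =
  occ_ratio K (fun x => FracField.tofrac (pin lambda M tau x))%R w X ->
  marginal H lambda U L sigma v = marginal K lambda X M tau w.
Proof.
move=> lambda_gt0 vU wX LU MX indL indM.
rewrite /occ_ratio !indpoly_tofrac => E.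
have nH Y : indpoly H (pin lambda L sigma) Y != 0%R.
  by apply: indpoly_neq0 => u; apply: pin_ge0.
have nK Y : indpoly K (pin lambda M tau) Y != 0%R.
  by apply: indpoly_neq0 => u; apply: pin_ge0.
move/eqP: E; rewrite eqr_div ?tofrac_eq0 // -!rmorphM tofrac_eq -!indpoly_in // => /eqP E.
rewrite !marginalE //; apply/eqP; rewrite eqr_div; first last.
- by rewrite gt_eqF // coef_indpoly_gt0.
- by rewrite gt_eqF // coef_indpoly_gt0.
rewrite -!coef_top_mul ?size_sum_pin // addnC; apply/eqP; congr (_`_ _)%R.
rewrite (indpoly_split _ _ wX) (indpoly_split _ _ vU) -!indpoly_in // !mulrDr.
by rewrite E mulrC.
Qed.

(** * Lifting boundary conditions along the labelling *)

Section Transfer.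
Local Open Scope ring_scope.
Variables (R : realType) (k d : nat) (lambda : R) (V : finType) (H : hypergraph V).
Hypothesis lambda_gt0 : 0 < lambda.
Hypotheses (size_le : edge_size_le H k.+1) (deg_le : degree_le H d.+1).
Variables (v0 : V) (Psi : {fset tree_vertex k d}) (L : {fset V}).
Hypothesis PsiE : forall x, (x \in Psi) = unfolds H v0 x.
Local Notation T := (hypertree k d).
Local Notation lbl := (label H (k := k) (d := d) v0).

Definition lifted : {fset tree_vertex k d} := [fset x in Psi | lbl x \in L].

Lemma independent_lifted (s : V -> bool) : independent H (occupied L s) ->
  independent T (occupied lifted (s \o lbl)).
Proof.
move=> /independentP ind; apply/independentP => x y; rewrite !inE /= !PsiE.
move=> /andP[/andP[ux xL] sx] /andP[/andP[uy yL] sy].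
apply/negP => /(label_adj ux uy); apply/negP; apply: ind.
  by rewrite !inE /= xL.
by rewrite !inE /= yL.
Qed.

Lemma marginal_lifted (s : V -> bool) : independent H (occupied L s) ->
  marginal T lambda Psi lifted (s \o lbl) (tree_root k d) =
  marginal H lambda [fset v | v : V] L s v0.
Proof.
move=> ind; apply: marginal_transfer => //.
- by rewrite in_fset.
- by apply/fsubsetP => x; rewrite in_fset => /andP[].
- by apply/fsubsetP => x _; rewrite in_fset.
- exact: independent_lifted.
pose w u := FracField.tofrac (pin lambda L s u).
(* On [Psi] the pins pulled back along the labelling are those of [lifted]; outside [Psi] the two
   activities may differ. *)
have agree (X : {fset tree_vertex k d}) : X `<=` Psi ->
    indpoly T (fun x => FracField.tofrac (pin lambda lifted (s \o lbl) x)) X =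
    indpoly T (fun x => w (lbl x)) X.
  move=> /fsubsetP XP; apply: eq_indpoly => x /XP xP.
  by rewrite /w /pin in_fset /= inE /= xP.
transitivity (occ_ratio T (fun x => w (lbl x)) (tree_root k d) Psi).
  rewrite /occ_ratio !agree; first last.
  - by apply/fsubsetP => x; rewrite in_link => /and3P[].
  - exact: fsubsetDl.
  by rewrite /w /pin in_fset /= inE /= PsiE.
transitivity (occ_ratio H w (root_state d v0).1.1 (root_state d v0).1.2); last by [].
apply: (occ_ratio_unfolding size_le deg_le) => //.
- by move=> U; rewrite indpoly_tofrac tofrac_eq0 indpoly_neq0 // => u; apply: pin_ge0.
- move=> X; rewrite /w (indpoly_tofrac T (fun x => pin lambda L s (lbl x))).
  by rewrite tofrac_eq0 indpoly_neq0 // => x; apply: pin_ge0.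
(* The root has neither a parent nor siblings. *)
- move=> y yP /adj_hypertree[//|[i [j]] //|[i [j [j' [t []]]]] //].
Qed.

End Transfer.

Theorem theorem13 (R : realType) (k d : nat) (lambda : R) (delta : nat -> R)
    (k_gt0 : (0 < k)%N) (d_gt0 : (0 < d)%N) (lambda_gt0 : 0 < lambda)
    (delta_ge0 : forall n : nat, 0 <= delta n)
    (tree_ssm : infinite_ssm (hypertree k d) lambda delta)
    (V : finType) (H : hypergraph V) :
  edge_size_le H k.+1 -> degree_le H d.+1 -> finite_ssm H lambda delta.
Proof.
move=> size_le deg_le v L sigma tau _ _ ind_sigma ind_tau.
have [Psi PsiE] := unfolding_ex H k d v.
have := tree_ssm Psi (tree_root k d) (lifted H v Psi L)
  (sigma \o label H v) (tau \o label H v).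
(* The two lifted conditions differ exactly on the lift of the disagreement set, so the distance is
   unchanged. *)
rewrite !marginal_lifted // (dist_unfolding size_le deg_le (v0 := v)
  (D := disagreement L sigma tau)); last first.
  by move=> x; rewrite !inE /= PsiE andbA.
apply.
- by rewrite PsiE.
- by apply/fsubsetP => x; rewrite in_fset => /andP[].
- exact: independent_lifted.
- exact: independent_lifted.
Qed.
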